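(* Let $0<q<1$, $1\le K<N$, $\varkappa\in\mathbb{GT}_K$, $\nu\in\mathbb{GT}_N$. Then \[ \frac{{}_q\mathrm{Dim}_{K,N}(\varkappa,\nu)}{{}_q\mathrm{Dim}_N\nu}=(-1)^{K(N-K)}\,q^{(N-K)|\varkappa|}\,q^{-K(N-K)(N+2)/2}\det\big[{}_qA_i(\varkappa_j-j)\big]_{i,j=1}^K, \] where for $i=1,\dots,K$ and $x\in\mathbb{Z}$ \[ {}_qA_i(x)={}_qA_i(x\mid K,N,\nu):=\frac{1-q^{N-K}}{2\pi i}\oint_{{}_q\mathfrak{C}(x)}\frac{(zq^{1-x};q)_{N-K-1}}{\prod_{r=i}^{N-K+i}(z-q^{-r})}\prod_{r=1}^N\frac{z-q^{-r}}{z-q^{\nu_r-r}}\,dz, \] and ${}_q\mathfrak{C}(x)$ is a positively oriented simple contour encircling the points $q^x,q^{x+1},\dots,q^{\nu_1-1}$ and not encircling the points $q^{x-1},q^{x-2},\dots,q^{\nu_N-N}$.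
   Context: $\mathbb{GT}_N$ is the set of integer tuples $\nu=(\nu_1\ge\dots\ge\nu_N)$, $\mathbb{GT}_0=\{\varnothing\}$; $|\nu|=\nu_1+\dots+\nu_N$, $|\varnothing|=0$. For $\mu\in\mathbb{GT}_{N-1}$, $\nu\in\mathbb{GT}_N$, $\mu\prec\nu$ means $\nu_1\ge\mu_1\ge\nu_2\ge\dots\ge\mu_{N-1}\ge\nu_N$; $\varnothing\prec\lambda$ for all $\lambda\in\mathbb{GT}_1$. Define \[ {}_q\mathrm{Dim}_N\nu=\sum q^{|\nu^{(1)}|+\dots+|\nu^{(N-1)}|}, \] the sum over all sequences $\varnothing\prec\nu^{(1)}\prec\dots\prec\nu^{(N)}=\nu$ with $\nu^{(m)}\in\mathbb{GT}_m$, and for $K<N$, $\varkappa\in\mathbb{GT}_K$, \[ {}_q\mathrm{Dim}_{K,N}(\varkappa,\nu)=\sum q^{|\varkappa|+|\nu^{(K+1)}|+\dots+|\nu^{(N-1)}|}, \] the sum over all sequences $\varkappa=\nu^{(K)}\prec\nu^{(K+1)}\prec\dots\prec\nu^{(N)}=\nu$. The $q$-Pochhammer symbol is $(a;q)_m=(1-a)(1-aq)\cdots(1-aq^{m-1})$, $(a;q)_0=1$. *)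

(* Defs.v *)
From HB Require Import structures.
From mathcomp Require Import all_boot all_order all_algebra.
From mathcomp Require Import complex.
From mathcomp Require Import all_classical all_reals all_analysis.

Set Implicit Arguments.
Unset Strict Implicit.
Unset Printing Implicit Defensive.

Import Order.TTheory GRing.Theory Num.Theory.
Import numFieldNormedType.Exports.

Local Open Scope classical_set_scope.
Local Open Scope ring_scope.
Local Open Scope complex_scope.

Definition GT (N : nat) : set (seq int) :=
  [set nu | size nu = N /\ sorted >=%R nu].

(* 1-based coordinates: [part nu r] is nu_r for 1 <= r <= N *)
Definition part (nu : seq int) (r : nat) : int := nth 0 nu r.-1.

Definition weight (nu : seq int) : int := \sum_(a <- nu) a.

Definition interlace (mu nu : seq int) : bool :=
  (size nu == (size mu).+1) &&
  all (fun r => part nu r.+1 <= part mu r <= part nu r) (iota 1 (size mu)).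

(* The sequences kappa = nu^(K) < nu^(K+1) < ... < nu^(N) = nu, recorded by
   their intermediate terms s = [:: nu^(K+1); ...; nu^(N-1)], for K < N *)
Definition GT_chains (K N : nat) (kappa nu : seq int) : set (seq (seq int)) :=
  [set s | [/\ size s = (N - K).-1,
               forall m, (m < size s)%N -> GT (K + m.+1) (nth [::] s m)
             & path interlace kappa (rcons s nu)]].

(* The index sets of these two sums are finite, so the finitely supported
   sums below are the actual sums over all chains *)
Definition qDim (R : realType) (q : R) (N : nat) (nu : seq int) : R :=
  \sum_(s \in GT_chains 0 N [::] nu) q ^ (\sum_(mu <- s) weight mu).

Definition qDimK (R : realType) (q : R) (K N : nat) (kappa nu : seq int) : R :=
  \sum_(s \in GT_chains K N kappa nu)
    q ^ (weight kappa + \sum_(mu <- s) weight mu).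

Definition qpoch (A : comNzRingType) (a q : A) (m : nat) : A :=
  \prod_(0 <= k < m) (1 - a * q ^+ k).

(* h is C^1 on [a, b]: its derivative on the open interval extends
   continuously to the closed one *)
Definition C1_on (R : realType) (h : R -> R) (a b : R) : Prop :=
  exists dh : R -> R, {within `[a, b], continuous dh} /\
    (forall t, a < t < b -> is_derive t 1 h (dh t)).

Definition piecewise_C1 (R : realType) (h : R -> R) : Prop :=
  {within `[0, 1], continuous h} /\
  exists s : seq R, [/\ path <%R 0 s, last 0 s = 1 &
    forall k, (k < size s)%N -> C1_on h (nth 0 (0 :: s) k) (nth 0 s k)].

Definition simple_contour (R : realType) (g : R -> R[i]) : Prop :=
  [/\ piecewise_C1 (fun t => complex.Re (g t)),
      piecewise_C1 (fun t => complex.Im (g t)),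
      g 0 = g 1 &
      forall s t, 0 <= s < 1 -> 0 <= t < 1 -> g s = g t -> s = t].

Definition on_contour (R : realType) (g : R -> R[i]) (z : R[i]) : Prop :=
  exists2 t : R, 0 <= t <= 1 & g t = z.

(* Junk values at the finitely many breakpoints do not affect integrals *)
Definition velocity (R : realType) (g : R -> R[i]) (t : R) : R[i] :=
  derive1 (fun u => complex.Re (g u)) t +i*
  derive1 (fun u => complex.Im (g u)) t.

Definition contour_integral (R : realType) (g : R -> R[i])
    (f : R[i] -> R[i]) : R[i] :=
  (\int[lebesgue_measure]_(t in `[0, 1]) complex.Re (f (g t) * velocity g t))
  +i*
  (\int[lebesgue_measure]_(t in `[0, 1]) complex.Im (f (g t) * velocity g t)).

Definition two_pi_i (R : realType) : R[i] := 2 * (pi : R)%:C * 'i.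

Definition winding (R : realType) (g : R -> R[i]) (a : R[i]) : R[i] :=
  (two_pi_i R)^-1 * contour_integral g (fun z => (z - a)^-1).

(* The inside of a simple closed contour is the set of points of nonzero
   winding number, its outside the set of points of winding number 0; the
   contour is positively oriented when it winds once around its inside *)
Definition encircles (R : realType) (g : R -> R[i]) (a : R[i]) : Prop :=
  ~ on_contour g a /\ winding g a <> 0.

Definition leaves_outside (R : realType) (g : R -> R[i]) (a : R[i]) : Prop :=
  ~ on_contour g a /\ winding g a = 0.

Definition positively_oriented (R : realType) (g : R -> R[i]) : Prop :=
  forall a, encircles g a -> winding g a = 1.

Definition is_qC (R : realType) (q : R) (N : nat) (nu : seq int) (x : int)
    (g : R -> R[i]) : Prop :=
  [/\ simple_contour g, positively_oriented g,
      forall m : int, x <= m <= part nu 1 - 1 -> encircles g (q ^ m)%:C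
    & forall m : int, part nu N - N%:Z <= m <= x - 1 ->
        leaves_outside g (q ^ m)%:C].

Definition qA_integrand (R : realType) (q : R) (K N : nat) (nu : seq int)
    (i : nat) (x : int) (z : R[i]) : R[i] :=
  qpoch (z * (q ^ (1 - x))%:C) q%:C (N - K).-1
  / \prod_(i <= r < (N - K + i).+1) (z - (q ^ (- r%:Z))%:C)
  * \prod_(1 <= r < N.+1)
      ((z - (q ^ (- r%:Z))%:C) / (z - (q ^ (part nu r - r%:Z))%:C)).

(* [g] is the contour of integration *)
Definition qA (R : realType) (q : R) (K N : nat) (nu : seq int)
    (g : R -> R[i]) (i : nat) (x : int) : R[i] :=
  (1 - q ^+ (N - K))%:C / two_pi_i R
  * contour_integral g (qA_integrand q K N nu i x).

(* Main.v *)
Require Import Defs.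
From HB Require Import structures.
From mathcomp Require Import all_boot all_order all_algebra.
From mathcomp Require Import perm complex.
From mathcomp Require Import all_classical all_reals all_analysis.
From mathcomp Require Import measurable_realfun.
From mathcomp Require Import ring lra zify.

Set Implicit Arguments.
Unset Strict Implicit.
Unset Printing Implicit Defensive.

Import Order.TTheory GRing.Theory Num.Theory.
Import numFieldNormedType.Exports.

Local Open Scope ring_scope.
Local Open Scope complex_scope.
Local Open Scope classical_set_scope.

(** Put n_i = nu_i - i, a_i = q^(n_i), k_j = kappa_j - j and L = N - K.

    For fixed nu the coordinates of an interlacing mu range independently over
    intervals, so summing q^|mu| det[psi_j(mu_i - i)] over mu replaces every
    psi_j by its discrete antiderivative (for the weight q^n) and adjoins a
    column of ones. Starting from the determinant of Kronecker deltas
    [n_i = k_j], which is the indicator of nu = kappa, L such steps express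
    qDim_(K,N) as an N x N determinant with K columns
    1[n_i >= k_j] q^(L k_j) (q^(n_i - k_j + 1); q)_(L-1) / (q; q)_(L-1)
    followed by the columns a_i^(L-1), ..., a_i, 1 up to constants. For K = 0
    this is a Vandermonde determinant.

    Multiplying on the left by the matrix of the functionals
    f |-> sum_r a_r^i f(a_r) / prod_(s <> r) (a_r - a_s), which kill the
    polynomials of degree < N - 1 - i, reduces the quotient of the two
    determinants to a K x K one. On the analytic side the integrand is a proper
    rational function with simple poles a_r, so partial fractions and linearity
    of the integral express qA_i(x) through the winding numbers, and these are
    the same functionals composed with multiplication by
    h_i(z) = prod_(r < i) (z - q^-r) prod_(r > L + i) (z - q^-r).
    The determinant of the coefficients of the h_i is a product, because
    h_i(q^-j) = 0 for j < i. *)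

(** * Lagrange interpolation *)

Lemma size_prod_XsubC_pred (F : idomainType) n (P : pred 'I_n) (x : 'I_n -> F) :
  size (\prod_(r < n | P r) ('X - (x r)%:P)) = #|P|.+1.
Proof.
by rewrite -big_filter size_prod_XsubC size_filter -sum1_count sum1_card.
Qed.

Section Interpolation.
Variables (F : fieldType) (N : nat) (a : 'I_N -> F).

Definition node_weight (r : 'I_N) : F := \prod_(s < N | s != r) (a r - a s).

Lemma size_prod_other_nodes (r : 'I_N) :
  size (\prod_(s < N | s != r) ('X - (a s)%:P)) = N.
Proof. by rewrite size_prod_XsubC_pred cardC1 card_ord; case: N r => // -[]. Qed.

Hypothesis a_inj : injective a.

Lemma node_weight_neq0 (r : 'I_N) : node_weight r != 0.
Proof.
apply/prodf_neq0 => s sr; rewrite subr_eq0; apply: contra_neq sr => e.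
by rewrite (a_inj e).
Qed.

Lemma lagrange_interpolation (P : {poly F}) : (size P <= N)%N ->
  P = \sum_r (P.[a r] / node_weight r) *:
        \prod_(s < N | s != r) ('X - (a s)%:P).
Proof.
move=> sP; apply/eqP; rewrite -subr_eq0; apply/eqP.
(* The difference of the two sides has size at most N and vanishes at the N distinct nodes. *)
apply: (@roots_geq_poly_eq0 _ _ (map a (enum 'I_N))).
- apply/allP => _ /mapP[r _ ->]; rewrite /root !hornerE horner_sum.
  rewrite (bigD1 r) //= [X in _ - (_ + X)]big1 => [|s sr].
    rewrite addr0 hornerZ horner_prod subr_eq0; apply/eqP.
    under eq_bigr do rewrite hornerXsubC.
    by rewrite divfK // node_weight_neq0.
  by rewrite hornerZ horner_prod (bigD1 r) 1?eq_sym //= hornerXsubC subrr mul0r mulr0.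
- by rewrite map_inj_uniq ?enum_uniq.
- rewrite size_map size_enum_ord.
  apply: leq_trans (size_polyD _ _) _; rewrite size_polyN geq_max sP /=.
  apply: leq_trans (size_sum _ _ _) _; apply/bigmax_leqP => r _.
  by apply: leq_trans (size_scale_leq _ _) _; rewrite size_prod_other_nodes.
Qed.

(** Compare the coefficients of degree N - 1 in the interpolation formula: every product over the
    other nodes is monic of that degree. *)
Lemma sum_node_weight (P : {poly F}) : (size P <= N)%N ->
  \sum_r P.[a r] / node_weight r = P`_N.-1.
Proof.
move=> sP; rewrite [in RHS](lagrange_interpolation sP) coef_sum.
apply: eq_bigr => r _; rewrite coefZ.
have /monicP : \prod_(s < N | s != r) ('X - (a s)%:P) \is monic.
  by rewrite rpred_prod // => s _; exact: monicXsubC.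
by rewrite lead_coefE size_prod_other_nodes => ->; rewrite mulr1.
Qed.

Lemma partial_fractions (P : {poly F}) (z : F) : (size P <= N)%N ->
  (forall r, z != a r) ->
  P.[z] / \prod_r (z - a r) = \sum_r P.[a r] / node_weight r / (z - a r).
Proof.
move=> sP za; rewrite [in LHS](lagrange_interpolation sP) horner_sum mulr_suml.
apply: eq_bigr => r _; rewrite hornerZ horner_prod.
under eq_bigr do rewrite hornerXsubC.
rewrite (bigD1 r (P := xpredT)) //= invfM mulrACA mulfV ?mulr1 ?mulrA //.
by apply/prodf_neq0 => s _; rewrite subr_eq0.
Qed.

End Interpolation.

Section InterpolationDeterminant.
Variables (F : fieldType) (K L : nat) (a : 'I_(K + L) -> F).
Hypothesis a_inj : injective a.
Let w := node_weight a.

Let V : 'M[F]_(K + L) := \matrix_(i, r) (a r ^+ i / w r).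

Lemma sum_node_weight_exp (m : nat) : (m < K + L)%N ->
  \sum_r a r ^+ m / w r = (m == (K + L).-1)%:R.
Proof.
move=> mN; have := @sum_node_weight _ _ _ a_inj 'X^m.
rewrite size_polyXn coefXn eq_sym => /(_ mN) <-.
by apply: eq_bigr => r _; rewrite hornerXn.
Qed.

(** With N = K + L, entry (i, j) of the matrix product is the sum of a_r^(N - 1 + i - j) / w_r,
    which is 0 for i < j and 1 for i = j. This also makes the Vandermonde determinant nonzero. *)
Lemma det_nodes_vandermonde :
  \det V * \det (\matrix_(r, j) a r ^+ ((K + L).-1 - j)) = 1.
Proof.
rewrite -det_mulmx det_trig; last first.
  apply/is_trig_mxP => i j ij; rewrite !mxE.
  under eq_bigr do rewrite !mxE mulrAC -exprD.
  rewrite sum_node_weight_exp; first by case: eqP => //; move: (ltn_ord j); lia.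
  by move: (ltn_ord j); lia.
apply: big1 => i _; rewrite !mxE.
under eq_bigr do rewrite !mxE mulrAC -exprD.
rewrite sum_node_weight_exp; first by case: eqP => //; move: (ltn_ord i); lia.
by move: (ltn_ord i); lia.
Qed.

Lemma det_nodes_neq0 : \det (\matrix_(r, j) a r ^+ ((K + L).-1 - j)) != 0.
Proof.
by apply: contra_eq_neq det_nodes_vandermonde => ->; rewrite mulr0 eq_sym oner_eq0.
Qed.

(** Multiplication by [V] makes the matrix block lower triangular: the first K rows meet the power
    columns only in exponents below K + L - 1, and the lower right block is unitriangular. *)
Lemma det_interpolation (f : 'I_K -> 'I_(K + L) -> F) :
  \det (row_mx (\matrix_(r, j) f j r) (\matrix_(r < K + L, j < L) a r ^+ (L.-1 - j)))
  / \det (\matrix_(r, j) a r ^+ ((K + L).-1 - j)) =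
  \det (\matrix_(i < K, j < K) \sum_r a r ^+ i * f j r / w r).
Proof.
apply: (canLR (mulfK det_nodes_neq0)).
set M := row_mx _ _; set B := \matrix_(i, j) _.
have detT : \det (\matrix_(i < L, j < L)
    \sum_r a r ^+ (K + i + (L.-1 - j)) / w r) = 1.
  rewrite det_trig; last first.
    apply/is_trig_mxP => i j ij; rewrite !mxE sum_node_weight_exp.
      by case: eqP => //; move: (ltn_ord i) (ltn_ord j); lia.
    by move: (ltn_ord i) (ltn_ord j); lia.
  apply: big1 => i _; rewrite !mxE sum_node_weight_exp.
    by case: eqP => //; move: (ltn_ord i); lia.
  by move: (ltn_ord i); lia.
have VE : V = col_mx (\matrix_(i < K, r < K + L) (a r ^+ i / w r))
                     (\matrix_(i < L, r < K + L) (a r ^+ (K + i) / w r)).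
  by apply/matrixP => i r; rewrite !mxE; case: splitP => j ij; rewrite !mxE ij.
have /(congr1 determinant) : V *m M = block_mx B 0
   ((\matrix_(i < L, r < K + L) (a r ^+ (K + i) / w r)) *m (\matrix_(r, j) f j r))
   (\matrix_(i < L, j < L) \sum_r a r ^+ (K + i + (L.-1 - j)) / w r).
  rewrite VE mul_col_row; congr block_mx; apply/matrixP => i j; rewrite !mxE;
    under eq_bigr do rewrite !mxE.
  - by apply: eq_bigr => r _; rewrite mulrAC.
  - under eq_bigr do rewrite mulrAC -exprD.
    rewrite sum_node_weight_exp; last by move: (ltn_ord i) (ltn_ord j); lia.
    by case: eqP => //; move: (ltn_ord i) (ltn_ord j); lia.
  - by apply: eq_bigr => r _; rewrite mulrAC -exprD.
rewrite det_mulmx det_lblock detT mulr1 => <-.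
rewrite -[LHS]mulr1 -det_nodes_vandermonde; ring.
Qed.

End InterpolationDeterminant.

(* Evaluating at the points [x j] makes the coefficient matrix triangular. *)
Lemma det_coef_staircase (F : fieldType) (K : nat) (x y : 'I_K -> F) :
  injective x ->
  \det (\matrix_(i < K, m < K)
     (\prod_(r < K | (r < i)%N) ('X - (x r)%:P) *
      \prod_(r < K | (i < r)%N) ('X - (y r)%:P))`_m) =
  \prod_(i < K) \prod_(r < K | (i < r)%N) (x i - y r).
Proof.
move=> x_inj.
pose h (i : 'I_K) := \prod_(r < K | (r < i)%N) ('X - (x r)%:P) *
  \prod_(r < K | (i < r)%N) ('X - (y r)%:P).
have sh i : (size (h i) <= K)%N.
  rewrite /h; apply: leq_trans (size_polyMleq _ _) _.
  rewrite !size_prod_XsubC_pred addSn /= addnS.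
  rewrite -cardUI [X in (_ + X)%N](_ : _ = 0%N) ?addn0; last first.
    by apply: eq_card0 => r; rewrite !inE; lia.
  (* The indices below and above i are together all indices but i, so [h i] has degree K - 1. *)
  rewrite [X in (X < _)%N](_ : _ = K.-1); last first.
    rewrite -[in RHS](card_ord K) -(cardC1 i).
    by apply: eq_card => r; rewrite !inE -neq_ltn.
  by case: K i {x y x_inj h} => // -[].
pose xv := \row_(j < K) x j.
have vdm0 : \det (Vandermonde K xv) != 0.
  rewrite det_Vandermonde; apply/prodf_neq0 => i _; apply/prodf_neq0 => j ij.
  rewrite !mxE subr_eq0; apply: contraTneq ij => /x_inj ->; lia.
(* The product with the Vandermonde matrix has entries h_i(x_j). The factor r = j kills those with j
   < i, and the diagonal contains the Vandermonde product, which then cancels. *)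
apply: (mulIf vdm0); rewrite -det_mulmx -det_tr det_trig; last first.
  apply/is_trig_mxP => i j ij; rewrite !mxE.
  under eq_bigr do rewrite !mxE.
  rewrite -(horner_coef_wide _ (sh j)) /h hornerM horner_prod.
  by rewrite (bigD1 i) //= hornerXsubC subrr !mul0r.
rewrite det_Vandermonde.
under eq_bigr => i _.
  rewrite !mxE.
  under eq_bigr do rewrite !mxE.
  rewrite -(horner_coef_wide _ (sh i)) /h hornerM !horner_prod.
  under eq_bigr do rewrite hornerXsubC.
  under [X in _ * X]eq_bigr do rewrite hornerXsubC.
  over.
rewrite big_split /= mulrC; congr (_ * _).
rewrite (exchange_big_dep xpredT) //=; apply: eq_bigr => i _.
by apply: eq_bigr => j _; rewrite !mxE.
Qed.

(** * Contour integrals of rational functions with simple poles *)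

Section BoundedMeasurable.
Variable R : realType.
Implicit Types (A B : set R) (f g h : R -> R).

(** Unlike integrability, this property passes to products, and on a segment it implies
    integrability. *)
Definition bounded_measurable A f :=
  measurable_fun A f /\ exists M : R, forall t, A t -> `|f t| <= M.

Lemma bounded_measurableD A f g : bounded_measurable A f ->
  bounded_measurable A g -> bounded_measurable A (fun t => f t + g t).
Proof.
move=> [mf [M Mf]] [mg [M' Mg]]; split; first exact: measurable_funD.
exists (M + M') => t At; apply: le_trans (ler_normD _ _) _.
by rewrite lerD ?Mf ?Mg.
Qed.

Lemma bounded_measurableM A f g : bounded_measurable A f ->
  bounded_measurable A g -> bounded_measurable A (fun t => f t * g t).
Proof.
move=> [mf [M Mf]] [mg [M' Mg]]; split; first exact: measurable_funM.
by exists (M * M') => t At; rewrite normrM ler_pM ?Mf ?Mg.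
Qed.

Lemma bounded_measurable_cst A (c : R) : bounded_measurable A (fun=> c).
Proof. by split; [exact: measurable_cst | exists `|c|]. Qed.

Lemma bounded_measurableB A f g : bounded_measurable A f ->
  bounded_measurable A g -> bounded_measurable A (fun t => f t - g t).
Proof.
move=> bf bg.
rewrite (_ : (fun t => _) = (fun t => f t + (-1) * g t)).
  by apply: bounded_measurableD => //; apply: bounded_measurableM => //;
     exact: bounded_measurable_cst.
by apply/funext => t; rewrite mulN1r.
Qed.

Lemma bounded_measurableU A B f : measurable A -> measurable B ->
  bounded_measurable A f -> bounded_measurable B f ->
  bounded_measurable (A `|` B) f.
Proof.
move=> mA mB [mf [M Mf]] [mg [M' Mg]]; split; first exact/measurable_funU.
exists (Num.max M M') => t [/Mf|/Mg] h; rewrite le_max h ?orbT //.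
Qed.

Lemma bounded_measurable_set1 (a : R) f : bounded_measurable [set a] f.
Proof.
split; first exact: measurable_fun_set1.
by exists `|f a| => t ->.
Qed.

Lemma bounded_measurable_within (a b : R) f :
  {within `[a, b], continuous f} -> bounded_measurable `[a, b] f.
Proof.
move=> cf; split.
  exact: subspace_continuous_measurable_fun.
have /compact_bounded[M [_ mrt]] := continuous_compact cf (@segment_compact R a b).
exists (M + 1) => t tab; apply: (mrt (M + 1)); first by rewrite ltrDl.
by exists t.
Qed.

(** On the open interval the derivative agrees with its continuous extension; its arbitrary values
    at the two endpoints are harmless, since singletons are measurable. *)
Lemma bounded_measurable_derive1 (a b : R) h : a < b -> C1_on h a b ->
  bounded_measurable `[a, b] (derive1 h).
Proof.
move=> ab [dh [cdh hd]].
have [mdh [M Mdh]] := bounded_measurable_within cdh.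
have sub : `]a, b[ `<=` `[a, b] by exact: subset_itv_oo_cc.
have hE t : t \in `]a, b[%R -> dh t = derive1 h t.
  rewrite in_itv /= => tab; have [_ E] := hd _ tab.
  by rewrite derive1E E.
have bo : bounded_measurable `]a, b[ (derive1 h).
  split.
    apply: (@eq_measurable_fun _ _ _ _ _ dh); last exact: measurable_funS mdh.
    by move=> t; rewrite inE /= => /hE.
  by exists M => t tab; rewrite -hE // Mdh //; exact: sub.
rewrite (_ : `[a, b]%classic = [set a] `|` (`]a, b[ `|` [set b])); last first.
  by rewrite setUA setU1itv ?setUitv1 ?bnd_simp // ltW.
apply: bounded_measurableU => //; [exact: measurableU | exact: bounded_measurable_set1|].
by apply: bounded_measurableU => //; exact: bounded_measurable_set1.
Qed.

Lemma bounded_measurable_piecewise (a : R) (s : seq R) h :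
  path <%R a s ->
  (forall k, (k < size s)%N -> C1_on h (nth 0 (a :: s) k) (nth 0 s k)) ->
  bounded_measurable `[a, last a s] (derive1 h).
Proof.
elim: s a => [|b s IH] a /=.
  move=> _ _; rewrite set_itv1; exact: bounded_measurable_set1.
move=> /andP[ab pbs] hC.
rewrite (_ : `[a, last b s]%classic = `[a, b] `|` `[b, last b s]); last first.
  have bl : b <= last b s.
    elim: s {IH hC ab} b pbs => //= c s IH b /andP[bc] /IH.
    by apply: le_trans; exact: ltW.
  apply/seteqP; split => t; rewrite /= !in_itv /=.
    by move=> /andP[-> ->]; rewrite andbT; apply/orP/le_total.
  by move=> []/andP[h1 h2]; apply/andP; split => //; lra.
apply: bounded_measurableU => //.
  by apply: bounded_measurable_derive1 => //; exact: (hC 0).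
by apply: IH => // k ks; exact: (hC k.+1).
Qed.

Lemma bounded_measurable_integrable (a b : R) f :
  bounded_measurable `[a, b] f ->
  (@lebesgue_measure R).-integrable `[a, b] (EFin \o f).
Proof.
move=> [mf [M Mf]]; apply: measurable_bounded_integrable => //.
  exact/compact_finite_measure/segment_compact.
exists M; split; first exact: num_real.
by move=> x Mx t /Mf /le_trans; apply; exact: ltW.
Qed.

End BoundedMeasurable.

Section BoundedMeasurableFinite.
Variable R : realType.
Implicit Types (A B : set R) (f g h : R -> R).

Lemma set_seq_cons (x : R) (s : seq R) : [set` x :: s] = x |` [set` s].
Proof.
apply/seteqP; split => y /=; rewrite inE.
  by move=> /orP[/eqP|]; [left | right].
by move=> [->|->]; rewrite ?eqxx ?orbT.
Qed.

Lemma measurable_set_seq (s : seq R) : measurable [set` s].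
Proof.
elim: s => [|x s IH]; first by rewrite set_nil; exact: measurable0.
by rewrite set_seq_cons; apply: measurableU.
Qed.

Lemma bounded_measurable_set_seq (s : seq R) f : bounded_measurable [set` s] f.
Proof.
elim: s => [|x s IH].
  rewrite set_nil; split; first exact: measurable_fun_set0.
  by exists 0.
rewrite set_seq_cons; apply: bounded_measurableU => //.
  exact: measurable_set_seq.
exact: bounded_measurable_set1.
Qed.

Lemma bounded_measurableS A B f : measurable B -> A `<=` B ->
  bounded_measurable B f -> bounded_measurable A f.
Proof.
move=> mB AB [mf [M Mf]]; split; first exact: measurable_funS mf.
by exists M => t /AB /Mf.
Qed.

Lemma bounded_measurable_eq A f h : {in A, f =1 h} ->
  bounded_measurable A f -> bounded_measurable A h.
Proof.
move=> fh [mf [M Mf]]; split; first exact: eq_measurable_fun mf.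
by exists M => t At; rewrite -fh ?inE //; exact: Mf.
Qed.

(** Finite sets are null, and every function is measurable on them, so measurability of [f] follows
    from that of [h]. This absorbs the values that division by zero gives to an integrand at
    removable singularities. *)
Lemma Rintegral_eq_finite (a b : R) (S : set R) f h : finite_set S ->
  bounded_measurable `[a, b] h -> {in `[a, b] `\` S, f =1 h} ->
  \int[lebesgue_measure]_(t in `[a, b]) f t =
  \int[lebesgue_measure]_(t in `[a, b]) h t.
Proof.
move=> /finite_seqP[s ->] bh fh.
have mS := measurable_set_seq s.
have [mf _] : bounded_measurable `[a, b] f.
  rewrite -(setDUK (@subIsetr _ [set` s] `[a, b])).
  apply: bounded_measurableU.
  - exact: measurableI.
  - by apply: measurableD => //; exact: measurableI.
  - apply: bounded_measurableS (bounded_measurable_set_seq s f) => //.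
  - apply: (@bounded_measurable_eq _ h) => [t|].
      by rewrite setDIr setDv setU0 => /fh.
    by apply: bounded_measurableS bh => //; exact: subDsetl.
congr fine; apply: ae_eq_integral => //.
- exact/measurable_EFinP.
- by apply/measurable_EFinP; case: bh.
- exists [set` s]; split => //.
    exact/countable_lebesgue_measure0/finite_set_countable.
  move=> t /= nt; apply: contrapT => ts; apply: nt => tab.
  by congr EFin; apply: fh; rewrite inE.
Qed.

End BoundedMeasurableFinite.

Lemma two_pi_i_neq0 (R : realType) : two_pi_i R != 0.
Proof.
rewrite /two_pi_i !mulf_neq0 ?pnatr_eq0 //.
  by rewrite (_ : 0 = (0 : R)%:C) // (inj_eq (@complexI _)) gt_eqF // pi_gt0.
by rewrite eq_complex /= oner_eq0 andbF.
Qed.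

(** * Linearity of the contour integral, and winding numbers *)

Section ContourIntegral.
Variables (R : realType) (g : R -> R[i]).
Implicit Types f : R[i] -> R[i].
Notation I01 := (`[0 : R, 1]%classic).

Definition contour_bounded_measurable f :=
  bounded_measurable I01 (fun t => complex.Re (f (g t) * velocity g t)) /\
  bounded_measurable I01 (fun t => complex.Im (f (g t) * velocity g t)).

Let cbm := contour_bounded_measurable.

Lemma contour_bounded_measurableD f1 f2 : cbm f1 -> cbm f2 ->
  cbm (fun z => f1 z + f2 z).
Proof.
move=> [r1 i1] [r2 i2]; split.
  apply: bounded_measurable_eq (bounded_measurableD r1 r2) => t _.
  by rewrite mulrDl raddfD.
apply: bounded_measurable_eq (bounded_measurableD i1 i2) => t _.
by rewrite mulrDl raddfD.
Qed.

Lemma contour_integralD f1 f2 : cbm f1 -> cbm f2 ->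
  contour_integral g (fun z => f1 z + f2 z) =
  contour_integral g f1 + contour_integral g f2.
Proof.
move=> [r1 i1] [r2 i2]; rewrite /contour_integral; simpc.
rewrite -!RintegralD //; try exact: bounded_measurable_integrable.
by congr (_ +i* _); apply: eq_Rintegral => t _; rewrite mulrDl raddfD.
Qed.

Lemma ReM (z w : R[i]) : complex.Re (z * w) =
  complex.Re z * complex.Re w - complex.Im z * complex.Im w.
Proof. by case: z w => [x y] [u v]. Qed.

Lemma ImM (z w : R[i]) : complex.Im (z * w) =
  complex.Re z * complex.Im w + complex.Im z * complex.Re w.
Proof. by case: z w => [x y] [u v]. Qed.

Lemma contour_bounded_measurableZ (c : R[i]) f : cbm f ->
  cbm (fun z => c * f z).
Proof.
move=> [rf jf]; split.
  apply: bounded_measurable_eq (bounded_measurableB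
    (bounded_measurableM (bounded_measurable_cst I01 (complex.Re c)) rf)
    (bounded_measurableM (bounded_measurable_cst I01 (complex.Im c)) jf)) => t _.
  by rewrite -mulrA [RHS]ReM.
apply: bounded_measurable_eq (bounded_measurableD
    (bounded_measurableM (bounded_measurable_cst I01 (complex.Re c)) jf)
    (bounded_measurableM (bounded_measurable_cst I01 (complex.Im c)) rf)) => t _.
by rewrite -mulrA [RHS]ImM.
Qed.

Lemma contour_integralZ (c : R[i]) f : cbm f ->
  contour_integral g (fun z => c * f z) = c * contour_integral g f.
Proof.
move=> [rf jf]; case: c => x y; rewrite /contour_integral; simpc.
have bZ (c : R) h : bounded_measurable I01 h ->
    bounded_measurable I01 (fun t => c * h t).
  by move=> bh; apply: bounded_measurableM => //; exact: bounded_measurable_cst.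
rewrite -!RintegralZl //; try exact: bounded_measurable_integrable.
rewrite -RintegralB // -?RintegralD //;
  try by apply: bounded_measurable_integrable; exact: bZ.
congr (_ +i* _); apply: eq_Rintegral => t _; rewrite -mulrA.
  by rewrite [LHS]ReM.
by rewrite [LHS]ImM.
Qed.

Lemma contour_bounded_measurable0 : cbm (fun=> 0).
Proof.
split.
  apply: bounded_measurable_eq (bounded_measurable_cst I01 0) => t _.
  by rewrite mul0r.
apply: bounded_measurable_eq (bounded_measurable_cst I01 0) => t _.
by rewrite mul0r.
Qed.

Lemma contour_integral0 : contour_integral g (fun=> 0) = 0.
Proof.
by have := contour_integralZ 0 contour_bounded_measurable0; rewrite !mul0r.
Qed.

Lemma contour_integral_sum (J : Type) (s : seq J) (F : J -> R[i] -> R[i]) :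
  (forall j, cbm (F j)) ->
  cbm (fun z => \sum_(j <- s) F j z) /\
  contour_integral g (fun z => \sum_(j <- s) F j z) =
  \sum_(j <- s) contour_integral g (F j).
Proof.
move=> bF; elim: s => [|j s [IHb IH]].
  under [fun z => _]eq_fun do rewrite big_nil.
  split; first exact: contour_bounded_measurable0.
  by rewrite big_nil contour_integral0.
rewrite big_cons -IH (_ : (fun z => _) = fun z => F j z + \sum_(j <- s) F j z).
  split; last exact: contour_integralD.
  exact: contour_bounded_measurableD.
by apply/funext => z; rewrite big_cons.
Qed.

Hypothesis g_simple : simple_contour g.

(** The squared distance from g(t) to a is continuous and has no zero on [0, 1], so 1/(g - a) is
    bounded; the velocity is bounded because the contour is piecewise C^1. *)
Lemma contour_bounded_measurable_inv (a : R[i]) : ~ on_contour g a ->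
  cbm (fun z => (z - a)^-1).
Proof.
have [[cRe [sRe [pRe lRe dRe]]] [cIm [sIm [pIm lIm dIm]]] _ _] := g_simple.
move=> ga.
have bRe : bounded_measurable I01 (derive1 (fun t => complex.Re (g t))).
  by rewrite -[X in `[_, X]]lRe; exact: bounded_measurable_piecewise.
have bIm : bounded_measurable I01 (derive1 (fun t => complex.Im (g t))).
  by rewrite -[X in `[_, X]]lIm; exact: bounded_measurable_piecewise.
pose u t := complex.Re (g t) - complex.Re a.
pose v t := complex.Im (g t) - complex.Im a.
have cu : {within I01, continuous u}.
  by move=> t; apply: cvgB; [exact: cRe | exact: cvg_cst].
have cv : {within I01, continuous v}.
  by move=> t; apply: cvgB; [exact: cIm | exact: cvg_cst].
have gE t : g t - a = u t +i* v t.
  by rewrite /u /v; case: (g t) => x y; case: (a) => x' y'; simpc.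
pose d t := u t ^+ 2 + v t ^+ 2.
have d0 t : I01 t -> d t != 0.
  rewrite /= in_itv /= => t01; rewrite /d paddr_eq0 ?sqr_ge0 // !sqrf_eq0.
  apply/negP => /andP[/eqP u0 /eqP v0]; apply: ga; exists t => //.
  by apply/eqP; rewrite -subr_eq0 gE u0 v0.
have cd : {within I01, continuous d}.
  by move=> t; apply: cvgD; apply: cvgM; (exact: cu || exact: cv).
have bdV : bounded_measurable I01 (fun t => (d t)^-1).
  apply: bounded_measurable_within; apply/subspace_continuousP => t t01.
  apply: cvgV; first exact: d0.
  by move/subspace_continuousP: cd; exact.
have bu := bounded_measurable_within cu.
have bv := bounded_measurable_within cv.
have iE t : (g t - a)^-1 = (u t / d t) +i* (- (v t / d t)).
  by rewrite gE; congr (_ +i* _).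
split.
  apply: bounded_measurable_eq (bounded_measurableD
    (bounded_measurableM (bounded_measurableM bu bdV) bRe)
    (bounded_measurableM (bounded_measurableM bv bdV) bIm)) => t _.
  by rewrite iE ReM /= mulNr opprK.
apply: bounded_measurable_eq (bounded_measurableB
    (bounded_measurableM (bounded_measurableM bu bdV) bIm)
    (bounded_measurableM (bounded_measurableM bv bdV) bRe)) => t _.
by rewrite iE ImM /= mulNr.
Qed.

Lemma finite_contour_preimage (S : seq R[i]) :
  finite_set (I01 `&` [set t | g t \in S]).
Proof.
have [_ _ _ ginj] := g_simple.
elim: S => [|z S IH].
  by apply: sub_finite_set (finite_set0 _) => t [].
have fib : finite_set (I01 `&` [set t | g t = z]).
  have [[t0 [/andP[t00 t01] gt0]]|no] :=
      pselect (exists t, 0 <= t < 1 /\ g t = z).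
    (* Injectivity is known on [0, 1) only, so the endpoint 1 is listed separately. *)
    apply: (@sub_finite_set _ _ [set` [:: t0; 1]]) => // t [] /=.
    rewrite in_itv /= => /andP[t0' t1'] gt; rewrite !inE.
    have [->|t1] := eqVneq t 1; first by rewrite orbT.
    apply/orP; left; apply/eqP; apply: ginj; rewrite ?t00 ?t0' //=.
      by rewrite lt_neqAle t1.
    by rewrite gt gt0.
  apply: (@sub_finite_set _ _ [set` [:: 1]]) => // t [] /=.
  rewrite in_itv /= => /andP[t0' t1'] gt; rewrite !inE.
  apply: contrapT => /negP t1; apply: no; exists t; split => //.
  by rewrite t0' lt_neqAle t1.
have := conj fib IH; rewrite -finite_setU; apply: sub_finite_set => t [tI] /=.
by rewrite inE => /orP[/eqP|]; [left | right].
Qed.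

(** For a sum of simple fractions the residue formula is mere linearity, as the winding numbers are
    themselves integrals of 1/(z - a). [S] lists points, possibly on the contour, where [f] may
    differ from the sum; a simple contour meets them at finitely many parameters. *)
Lemma contour_integral_partial_fractions (n : nat) (a c : 'I_n -> R[i])
    (S : seq R[i]) f :
  (forall r, ~ on_contour g (a r)) ->
  (forall z, (forall r, z != a r) -> z \notin S ->
     f z = \sum_r c r / (z - a r)) ->
  contour_integral g f = two_pi_i R * \sum_r c r * winding g (a r).
Proof.
move=> ga fE.
have bF r : cbm (fun z => c r * (z - a r)^-1).
  exact/contour_bounded_measurableZ/contour_bounded_measurable_inv.
have [[br bi] IE] := contour_integral_sum (index_enum 'I_n) bF.
transitivity (contour_integral g (fun z => \sum_r c r / (z - a r))).
  have fin := finite_contour_preimage S.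
  have E t : t \in I01 `\` (I01 `&` [set t | g t \in S]) ->
      f (g t) = \sum_r c r / (g t - a r).
    rewrite inE => -[t01 nt]; apply: fE => [r|].
      by apply/eqP => gt; apply: (ga r); exists t => //; move: t01; rewrite /= in_itv.
    by apply/negP => gS; apply: nt.
  by congr (_ +i* _); apply: Rintegral_eq_finite fin _ _ => // t /E ->.
rewrite {}IE mulr_sumr; apply: eq_bigr => r _.
rewrite contour_integralZ; last exact: contour_bounded_measurable_inv.
by rewrite /winding mulrCA mulVKf // two_pi_i_neq0.
Qed.

End ContourIntegral.

(** * Sums over Gelfand-Tsetlin chains *)

(** This enumerates the interval from a to b only when a <= b, which holds for consecutive
    coordinates of a tuple in [GT]. *)
Definition int_range (a b : int) : seq int :=
  [seq a + k%:Z | k <- iota 0 `|b - a|%N.+1].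

Lemma mem_int_range (a b x : int) : a <= b ->
  (x \in int_range a b) = (a <= x <= b).
Proof.
move=> ab; apply/mapP/idP => [[k] | ].
  by rewrite mem_iota => kab ->; lia.
by move=> xab; exists `|x - a|%N; rewrite ?mem_iota; lia.
Qed.

Lemma uniq_int_range (a b : int) : uniq (int_range a b).
Proof. by rewrite map_inj_uniq ?iota_uniq // => x y; lia. Qed.

Lemma telescope_int_range (V : zmodType) (G : int -> V) (a b : int) : a <= b ->
  \sum_(m <- int_range a b) (G m - G (m - 1)) = G b - G (a - 1).
Proof.
move=> ab; rewrite big_map -[X in iota _ X]subn0 -/(index_iota _ _).
rewrite (eq_bigr (fun k : nat => G (a - 1 + k.+1%:Z) - G (a - 1 + k%:Z))).
  rewrite telescope_sumr // addr0; congr (G _ - _); lia.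
by move=> k _; congr (G _ - G _); lia.
Qed.

Fixpoint seq_prod (n : nat) (I : nat -> seq int) : seq (seq int) :=
  if n is n'.+1 then [seq x :: t | x <- I 0%N, t <- seq_prod n' (I \o succn)]
  else [:: [::]].

Lemma mem_seq_prod n I t :
  reflect (size t = n /\ forall i, (i < n)%N -> nth 0 t i \in I i)
          (t \in seq_prod n I).
Proof.
elim: n I t => [|n IH] I t /=.
  rewrite inE; apply: (iffP eqP) => [->//|[]].
  by case: t.
apply: (iffP allpairsPdep) => [[x [s [xI sI ->]]]|[]].
  have [sz sn] := IH _ _ sI; split => /=; first by rewrite sz.
  by case.
case: t => // x s [sz] sn; exists x, s; split => //; first exact: (sn 0%N).
by apply/IH; split => // i ilt; exact: (sn i.+1).
Qed.

Lemma uniq_seq_prod n I : (forall i, uniq (I i)) -> uniq (seq_prod n I).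
Proof.
elim: n I => // n IH I uI /=; apply: allpairs_uniq => //.
  by apply: IH => i; exact: uI.
by move=> [x s] [y t] _ _ [-> ->].
Qed.

Lemma sum_seq_prod (A : comPzSemiRingType) n I (G : 'I_n -> int -> A) :
  \sum_(t <- seq_prod n I) \prod_(i < n) G i (nth 0 t i) =
  \prod_(i < n) \sum_(x <- I i) G i x.
Proof.
elim: n I G => [|n IH] I G; first by rewrite /= big_seq1 !big_ord0.
rewrite /= big_allpairs_dep big_ord_recl mulr_suml; apply: eq_bigr => x _.
rewrite -(IH (I \o succn) (fun i => G (lift ord0 i))).
rewrite mulr_sumr; apply: eq_bigr => t _.
by rewrite big_ord_recl.
Qed.

Definition interlacing (nu : seq int) : seq (seq int) :=
  seq_prod (size nu).-1 (fun i => int_range (nth 0 nu i.+1) (nth 0 nu i)).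

Lemma uniq_interlacing nu : uniq (interlacing nu).
Proof. by apply: uniq_seq_prod => i; exact: uniq_int_range. Qed.

Lemma GT_nth N nu i : GT N nu -> (i.+1 < N)%N -> nth 0 nu i.+1 <= nth 0 nu i.
Proof. by move=> [<- /sortedP] /(_ 0); apply. Qed.

Lemma mem_interlacing N nu mu : GT N.+1 nu ->
  (mu \in interlacing nu) = interlace mu nu.
Proof.
move=> gt; have [sz _] := gt; apply/mem_seq_prod/idP; rewrite sz /=.
  move=> [smu nmu]; rewrite /interlace sz smu eqxx /=.
  apply/allP => r; rewrite mem_iota => /andP[r1 rN].
  case: r r1 rN => // r _ rN; have rN' : (r < N)%N by lia.
  have := nmu r rN'; rewrite mem_int_range //.
  by apply: GT_nth gt _; lia.
move=> /andP[/eqP]; rewrite sz => -[smu] /allP a; split => // i iN.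
rewrite mem_int_range; last by apply: GT_nth gt _; lia.
by have := a i.+1; rewrite mem_iota; apply; lia.
Qed.

Lemma interlace_GT N nu mu : GT N.+1 nu -> interlace mu nu -> GT N mu.
Proof.
move=> [sz _] /andP[/eqP]; rewrite sz => -[smu] /allP a; split => //.
apply/(sortedP 0) => i iN.
have iN' : (i.+1 < N)%N by rewrite smu.
have /andP[h1 _] : part nu i.+2 <= part mu i.+1 <= part nu i.+1.
  by apply: a; rewrite mem_iota -smu; lia.
have /andP[_ h2] : part nu i.+3 <= part mu i.+2 <= part nu i.+2.
  by apply: a; rewrite mem_iota -smu; lia.
exact: le_trans h2 h1.
Qed.

Fixpoint chain_list (l : nat) (kappa nu : seq int) : seq (seq (seq int)) :=
  if l is l'.+1 then
    [seq rcons s mu | mu <- interlacing nu, s <- chain_list l' kappa mu]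
  else if interlace kappa nu then [:: [::]] else [::].

Lemma uniq_chain_list l kappa nu : uniq (chain_list l kappa nu).
Proof.
elim: l nu => [|l IH] nu /=; first by case: ifP.
apply: allpairs_uniq_dep => [|mu _|[mu s] [mu' s'] _ _ /= /rcons_inj[-> ->]] //.
exact: uniq_interlacing.
Qed.

(** The enumeration never tests membership in [GT]: going down from nu, interlacing forces it at
    every level. *)
Lemma GT_chains_list K l kappa nu : GT (K + l.+1) nu ->
  GT_chains K (K + l.+1) kappa nu = [set` chain_list l kappa nu].
Proof.
elim: l nu => [|l IH] nu gt.
  rewrite /GT_chains addn1 subSnn /=; apply/seteqP; split => s /=.
    by move=> [/size0nil -> _]; rewrite /= andbT => ->.
  by case: ifP => // kn; rewrite inE => /eqP ->; split; rewrite //= kn.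
have gt' : GT (K + l.+1).+1 nu by rewrite -addnS.
apply/seteqP; split => s.
  rewrite /GT_chains addKn /= => -[sz gts].
  case/lastP: s sz gts => // s mu; rewrite size_rcons => -[sz] gts.
  rewrite rcons_path last_rcons => /andP[pth mn].
  have gm := gts l; rewrite nth_rcons sz ltnn eqxx in gm.
  apply/allpairsPdep; exists mu, s; split => //.
    by rewrite (mem_interlacing _ gt').
  have := IH mu (gm (ltnSn _)) => /seteqP[+ _]; apply; split.
  - by rewrite addKn.
  - move=> m ms; have := gts m; rewrite nth_rcons ms; apply; lia.
  - by [].
move=> /allpairsPdep[mu [t [muI tI ->]]].
rewrite (mem_interlacing _ gt') in muI.
have gm := interlace_GT gt' muI.
have /seteqP[_ +] := IH mu gm => /(_ _ tI) [sz gts pth].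
rewrite addKn /= in sz.
split.
- by rewrite size_rcons sz addKn.
- move=> m; rewrite size_rcons sz => ml; rewrite nth_rcons sz.
  case: ifP => [ml'|ml']; first by apply: gts; rewrite sz.
  have -> : m = l by lia.
  by rewrite eqxx.
- by rewrite rcons_path last_rcons pth.
Qed.

(** The recursion ends with the indicator of nu = kappa instead of an interlacing condition. The
    lowest summation thus selects kappa and supplies the factor q^|kappa|. *)
Fixpoint chain_sum (F : fieldType) (q : F) (l : nat) (kappa nu : seq int) : F :=
  if l is l'.+1 then
    \sum_(mu <- interlacing nu) q ^ weight mu * chain_sum q l' kappa mu
  else (kappa == nu)%:R.

Lemma sum_chain_list (F : fieldType) (q : F) N l kappa nu : q != 0 ->
  GT (N + l.+1) nu ->
  \sum_(s <- chain_list l kappa nu) q ^ (weight kappa + \sum_(mu <- s) weight mu)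
  = chain_sum q l.+1 kappa nu.
Proof.
move=> q0; elim: l nu => [|l IH] nu nuG.
  rewrite addn1 in nuG; rewrite /= -(mem_interlacing _ nuG).
  case: ifP => kn; last first.
    rewrite big_nil big_seq big1 // => mu mui.
    by case: eqP => [E|]; [rewrite E mui in kn | rewrite mulr0].
  rewrite big_seq1 big_nil addr0 (bigD1_seq kappa) ?uniq_interlacing //=.
  rewrite eqxx mulr1 big1 ?addr0 // => mu; rewrite eq_sym => /negbTE ->.
  by rewrite mulr0.
have nuG' : GT (N + l.+1).+1 nu by rewrite -addnS.
rewrite [LHS]/= big_allpairs_dep [RHS]/=.
rewrite big_seq [RHS]big_seq; apply: eq_bigr => mu mui.
have gm : GT (N + l.+1) mu.
  by apply: (interlace_GT nuG'); rewrite -(mem_interlacing _ nuG').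
rewrite -[X in _ * X](IH _ gm) mulr_sumr; apply: eq_bigr => s _.
by rewrite -cats1 big_cat big_seq1 -expfzDr // addrA addrC.
Qed.

Lemma qDimK_chain_sum (R : realType) (q : R) K l kappa nu : q != 0 ->
  GT (K + l.+1) nu ->
  qDimK q K (K + l.+1) kappa nu = chain_sum q l.+1 kappa nu.
Proof.
move=> q0 gt; rewrite /qDimK GT_chains_list // -fsbig_seq ?uniq_chain_list //.
exact: sum_chain_list gt.
Qed.

Lemma qDim_qDimK (R : realType) (q : R) N nu : qDim q N nu = qDimK q 0 N [::] nu.
Proof.
rewrite /qDimK /weight big_nil.
by under [RHS]eq_fsbigr do rewrite add0r.
Qed.

(** Indices start at 0 here, so this is nu_(i+1) - (i+1) in the usual numbering. The shift makes
    weakly decreasing coordinates strictly decreasing. *)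
Definition shifted (nu : seq int) (i : nat) : int := nth 0 nu i - i.+1%:Z.

Lemma shifted_lt N nu i j : GT N nu -> (i < j < N)%N ->
  shifted nu j < shifted nu i.
Proof.
move=> gt /andP[ij jN]; elim: j ij jN => // j IH; rewrite ltnS leq_eqVlt.
move=> /orP[/eqP->|ij] jN.
  by have := GT_nth gt jN; rewrite /shifted; lia.
have := IH ij (ltnW jN); have := GT_nth gt jN; rewrite /shifted; lia.
Qed.

Lemma shifted_inj N nu i j : GT N nu -> (i < N)%N -> (j < N)%N ->
  shifted nu i = shifted nu j -> i = j.
Proof.
move=> gt iN jN e; case: (ltngtP i j) => // ij.
  by have := @shifted_lt _ _ i j gt; rewrite ij jN e ltxx => /(_ isT).
by have := @shifted_lt _ _ j i gt; rewrite ij iN e ltxx => /(_ isT).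
Qed.

(* A nonvanishing term of the determinant is a permutation matching the two
   strictly decreasing sequences of shifted coordinates. *)
Lemma det_shifted_delta (F : fieldType) K kappa nu : GT K kappa -> GT K nu ->
  \det (\matrix_(i < K, j < K) (shifted nu i == shifted kappa j)%:R) =
  (kappa == nu)%:R :> F.
Proof.
move=> gk gn; have [E|kn] := eqVneq kappa nu.
  rewrite -E (_ : \matrix_(i, j) _ = 1%:M) ?det1 //; apply/matrixP => i j.
  rewrite !mxE; congr (_%:R); congr nat_of_bool.
  apply/eqP/eqP => [/(shifted_inj gk)|->] // e.
  by apply: val_inj; exact: e.
rewrite /determinant big1 // => s _.
have [/forallP sE|] := boolP [forall i : 'I_K, shifted nu i == shifted kappa (s i)].
  case/eqP: kn; pose sh (l : seq int) := [seq shifted l i | i <- iota 0 K].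
  have dec l : GT K l -> sorted >%R (sh l).
    move=> gl; apply/(sortedP 0) => i; rewrite size_map size_iota => iK.
    rewrite !(nth_map 0%N) ?size_iota ?nth_iota //; try lia.
    by apply: (shifted_lt gl); lia.
  have shE : sh kappa = sh nu.
    apply: (irr_sorted_eq (rev_trans lt_trans) (fun x => ltxx x));
      [exact: dec | exact: dec |].
    move=> x; apply/mapP/mapP => -[k]; rewrite mem_iota add0n => /andP[_ kK] ->.
      have /eqP := sE (s^-1%g (Ordinal kK)); rewrite permKV /= => <-.
      by exists (val (s^-1%g (Ordinal kK))) => //; rewrite mem_iota ltn_ord.
    exists (val (s (Ordinal kK))); first by rewrite mem_iota ltn_ord.
    exact/eqP/(sE (Ordinal kK)).
  have [[sk _] [sn _]] := (gk, gn).
  apply: (@eq_from_nth _ 0); first by rewrite sk sn.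
  move=> i; rewrite sk => iK; have := congr1 (nth 0 ^~ i) shE.
  rewrite !(nth_map 0%N) ?size_iota // nth_iota // add0n /shifted; lia.
rewrite negb_forall => /existsP[i ne].
by rewrite (bigD1 i) //= !mxE (negbTE ne) mul0r mulr0.
Qed.

(** Subtracting from each row the next one, by the unitriangular [E], turns the column of ones into
    (0, ..., 0, 1); expansion along it leaves the differences. *)
Lemma det_successive_differences (A : comNzRingType) N (f : nat -> nat -> A) :
  \det (\matrix_(i < N, j < N) (f i j - f i.+1 j)) =
  \det (\matrix_(i < N.+1, j < N.+1) if (j < N)%N then f i j else 1).
Proof.
pose E : 'M[A]_N.+1 := \matrix_(i, k) ((k == i :> nat)%:R - (k == i.+1 :> nat)%:R).
have detE : \det E = 1.
  rewrite -det_tr det_trig.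
    apply: big1 => i _; rewrite !mxE eqxx.
    by case: eqP => [|_]; [lia | rewrite subr0].
  apply/is_trig_mxP => i j ij; rewrite !mxE.
  by do 2 case: eqP => [|_]; try lia; rewrite subrr.
set M := (X in _ = \det X).
rewrite -[RHS]mul1r -detE -det_mulmx (expand_det_col _ ord_max).
(* The last row has no successor, whence the [insub]. *)
have EM i j : (E *m M) i j =
    M i j - (if insub i.+1 is Some k then M k j else 0).
  rewrite !mxE; under eq_bigr do rewrite mxE mulrBl.
  rewrite sumrB; congr (_ - _).
    rewrite (bigD1 i) //= eqxx mul1r big1 ?addr0 ?mxE // => k ki.
    by rewrite (_ : (k == i :> nat) = false) ?mul0r //; exact/negbTE.
  case: insubP => [k _ ki|iN].
    rewrite (bigD1 k) //= ki eqxx mul1r big1 ?addr0 // => k' kk.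
    by rewrite -ki (_ : (k' == k :> nat) = false) ?mul0r //; exact/negbTE.
  rewrite big1 // => k _; case: eqP => [ki|]; last by rewrite mul0r.
  by move: (ltn_ord k) iN; rewrite ki => ->.
rewrite (bigD1 ord_max) //= big1 ?addr0 => [|i im].
  rewrite EM insubF ?ltnn // subr0 !mxE ltnn mul1r /cofactor addnn -signr_odd.
  rewrite odd_double expr0 mul1r; congr determinant.
  apply/matrixP => i j; rewrite !mxE.
  have lo (k : 'I_N) : lift ord_max k = k :> nat by rewrite /= /bump leqNgt ltn_ord.
  have := EM (lift ord_max i) (lift ord_max j); rewrite [LHS]mxE => ->.
  rewrite lo; case: insubP => [k _ ki|]; last by rewrite ltnS ltn_ord.
  by rewrite !mxE ki !lo ltn_ord.
rewrite EM; case: insubP => [k _ ki|].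
  by rewrite !mxE ltnn subrr mul0r.
have : (i < N)%N by rewrite ltn_neqAle -ltnS ltn_ord andbT.
by rewrite -ltnS => ->.
Qed.

Lemma weight_prod (F : fieldType) (q : F) mu : q != 0 ->
  q ^ weight mu = \prod_(i < size mu) q ^ nth 0 mu i.
Proof.
move=> q0; rewrite /weight (big_nth 0) big_mkord.
by elim/big_rec2: _ => [|i x y _ <-]; rewrite ?expfzDr.
Qed.

(** In the Leibniz expansion each term is a product over coordinates that range independently, so
    the sum factors into one-dimensional sums, and each of them telescopes. *)
Lemma sum_interlacing_det (F : fieldType) (q : F) N nu
    (psi Psi : nat -> int -> F) : q != 0 -> GT N.+1 nu ->
  (forall j n, (j < N)%N -> Psi j n - Psi j (n - 1) = q ^ n * psi j n) ->
  \sum_(mu <- interlacing nu)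
     q ^ weight mu * \det (\matrix_(i < N, j < N) psi j (shifted mu i)) =
  \prod_(i < N) q ^+ i.+1 *
  \det (\matrix_(i < N.+1, j < N.+1)
          if (j < N)%N then Psi j (shifted nu i) else 1).
Proof.
move=> q0 gt dPsi; have [sz _] := gt.
rewrite -(det_successive_differences _ (fun i j => Psi j (shifted nu i))).
rewrite /interlacing sz /=; set I := fun i => _.
transitivity (\sum_(s : 'S_N) (-1) ^+ s *
  \sum_(mu <- seq_prod N I)
    \prod_(i < N) (q ^ nth 0 mu i * psi (s i) (nth 0 mu i - i.+1%:Z))).
  under [RHS]eq_bigr do rewrite mulr_sumr.
  rewrite exchange_big /= big_seq [RHS]big_seq; apply: eq_bigr => mu.
  move=> /mem_seq_prod[smu _]; rewrite weight_prod // smu.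
  rewrite /determinant mulr_sumr; apply: eq_bigr => s _.
  rewrite mulrCA -big_split /=; congr (_ * _); apply: eq_bigr => i _.
  by rewrite mxE.
rewrite /determinant mulr_sumr; apply: eq_bigr => s _.
rewrite (sum_seq_prod _ (fun i x => q ^ x * psi (s i) (x - i.+1%:Z))).
rewrite mulrCA -big_split /=; congr (_ * _); apply: eq_bigr => i _.
rewrite !mxE.
(* The prefactor arises from q^x = q^(i+1) q^(x - (i+1)). *)
rewrite (eq_bigr (fun x => q ^+ i.+1 * (Psi (s i) (x - i.+1%:Z) -
    Psi (s i) (x - 1 - i.+1%:Z)))) => [|x _].
  rewrite -mulr_sumr.
  rewrite (telescope_int_range (fun x => Psi (s i) (x - i.+1%:Z))).
    (* The lower end of the telescoping sum, moved by one, is exactly the next shifted coordinate of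
       nu. *)
    rewrite /shifted; congr (_ * (_ - Psi _ _)).
    by rewrite -addrA -opprD.
  by apply: (GT_nth gt); rewrite ltnS.
rewrite (_ : x - 1 - _ = x - i.+1%:Z - 1); last by lia.
rewrite dPsi // mulrA exprnP -expfzDr //; congr (_ ^ _ * _); lia.
Qed.

(** * The determinantal formula for the q-dimensions *)

Lemma qpochSr (A : comNzRingType) (a q : A) m :
  qpoch a q m.+1 = qpoch a q m * (1 - a * q ^+ m).
Proof. by rewrite /qpoch big_nat_recr. Qed.

Lemma qpochSl (A : comNzRingType) (a q : A) m :
  qpoch a q m.+1 = (1 - a) * qpoch (a * q) q m.
Proof.
rewrite /qpoch big_nat_recl // expr0 mulr1; congr (_ * _).
by apply: eq_bigr => k _; rewrite exprS mulrA.
Qed.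

Lemma qpoch0 (A : comNzRingType) (a q : A) : qpoch a q 0 = 1.
Proof. by rewrite /qpoch big_nil. Qed.

Section LevelFunctions.
Variables (F : fieldType) (q : F).
Hypothesis q_neq0 : q != 0.
Hypothesis q_not_root : forall m, q ^+ m.+1 != 1.

Lemma qpoch_neq0 m : qpoch q q m != 0.
Proof.
elim: m => [|m IH]; first by rewrite qpoch0 oner_eq0.
by rewrite qpochSr mulf_neq0 // -exprS subr_eq0 eq_sym.
Qed.

Lemma qpochV_neq0 m : qpoch q^-1 q^-1 m != 0.
Proof.
elim: m => [|m IH]; first by rewrite qpoch0 oner_eq0.
by rewrite qpochSr mulf_neq0 // -exprS subr_eq0 eq_sym exprVn invr_eq1.
Qed.

(* The [l]-fold iterate of [psi |-> \sum_(m <= n) q ^ m psi(m)] applied to the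
   indicator of [k]. *)
Definition iterated_delta (l : nat) (k n : int) : F :=
  if l is l'.+1 then
    if k <= n then q ^ (l%:Z * k) * qpoch (q ^ (n - k + 1)) q l' / qpoch q q l'
    else 0
  else (n == k)%:R.

(** With m = n - k >= 0, the positive levels rest on (q^(m+1); q)_(l+1) - (q^m; q)_(l+1) = q^m (1 -
    q^(l+1)) (q^(m+1); q)_l. *)
Lemma iterated_delta_diff l k n :
  iterated_delta l.+1 k n - iterated_delta l.+1 k (n - 1) =
  q ^ n * iterated_delta l k n.
Proof.
case: l => [|l]; rewrite /iterated_delta.
  rewrite !qpoch0 divr1 !mulr1 mul1r.
  case: (ltgtP n k) => nk.
  - by rewrite ifN ?subrr ?mulr0 //; lia.
  - by rewrite ifT ?subrr ?mulr0 //; lia.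
  - by rewrite nk ifN ?subr0 ?mulr1 //; lia.
have [kn|nk] := leP k n; last by rewrite ifN ?subrr ?mulr0 //; lia.
(* For n = k the closed form vanishes too, through its first factor 1 - q^0, so the case distinction
   disappears. *)
have -> : (if k <= n - 1 then q ^ (l.+2%:Z * k) * qpoch (q ^ (n - 1 - k + 1)) q l.+1
    / qpoch q q l.+1 else 0)
   = q ^ (l.+2%:Z * k) * qpoch (q ^ (n - k)) q l.+1 / qpoch q q l.+1.
  case: ifP => kn1; first by rewrite (_ : n - 1 - k + 1 = n - k) //; lia.
  by rewrite (_ : n - k = 0) ?expr0z ?qpochSl ?subrr ?mul0r ?mulr0 ?mul0r //; lia.
rewrite [qpoch (q ^ (n - k)) q l.+1]qpochSl.
rewrite [qpoch (q ^ (n - k + 1)) q l.+1]qpochSr [qpoch q q l.+1]qpochSr.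
rewrite (_ : q ^ (n - k) * q = q ^ (n - k + 1)); last by rewrite -{2}(expr1z q) -expfzDr.
rewrite (_ : q ^ (n - k + 1) = q ^ (n - k) * q); last by rewrite -{3}(expr1z q) -expfzDr.
rewrite (_ : l.+2%:Z * k = l.+1%:Z * k + k); last by lia.
rewrite (expfzDr _ k q_neq0) (_ : n = n - k + k); last by lia.
rewrite (_ : n - k + k - k = n - k); last by lia.
rewrite (expfzDr _ k q_neq0).
have h1 := qpoch_neq0 l.
have h2 : 1 - q * q ^+ l != 0 by rewrite -exprS subr_eq0 eq_sym.
by field; rewrite h1 h2.
Qed.

(* Columns of the [N x N] determinant: the first [K] come from the initial
   condition [kappa], the others are the constant columns introduced at each
   level, summed [N.-1 - j] times. *)
Definition level_fun (K : nat) (k : nat -> int) (N j : nat) (n : int) : F :=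
  if (j < K)%N then iterated_delta (N - K) (k j) n
  else (q ^ n) ^+ (N.-1 - j) / qpoch q^-1 q^-1 (N.-1 - j).

(** On a power column, q^(n(m+1)) - q^((n-1)(m+1)) = q^(n(m+1)) (1 - q^-(m+1)), and the last factor
    is the new one in the Pochhammer symbol of base 1/q. *)
Lemma level_fun_diff K k N j n : (K <= N)%N -> (j < N)%N ->
  level_fun K k N.+1 j n - level_fun K k N.+1 j (n - 1) =
  q ^ n * level_fun K k N j n.
Proof.
move=> KN jN; rewrite /level_fun; case: ifP => jK.
  by rewrite subSn // iterated_delta_diff.
have -> : (N.+1.-1 - j = (N.-1 - j).+1)%N by lia.
move: (N.-1 - j)%N => m; rewrite expfzDr // exprN1 qpochSr exprMn.
have h1 := qpochV_neq0 m.
have h2 : 1 - q^-1 * q^-1 ^+ m != 0.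
  by rewrite -exprS exprVn subr_eq0 eq_sym invr_eq1.
rewrite [(q ^ n) ^+ m.+1]exprS [q^-1 ^+ m.+1]exprS.
move: h1 h2; set b := qpoch _ _ _; set c := q^-1 ^+ m; move: b c => b c h1 h2.
set e := 1 - _ in h2 *; rewrite (_ : q^-1 * c = 1 - e); last by rewrite subKr.
by field; rewrite h1 h2.
Qed.

Lemma chain_sum_det K kappa l N nu : N = (K + l)%N -> GT K kappa -> GT N nu ->
  chain_sum q l kappa nu =
  \prod_(K <= M < N) \prod_(i < M) q ^+ i.+1 *
  \det (\matrix_(i < N, j < N) level_fun K (shifted kappa) N j (shifted nu i)).
Proof.
elim: l N nu => [|l IH] N nu.
  rewrite addn0 => -> gk gn; rewrite big_geq // mul1r /= -(det_shifted_delta _ gk gn).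
  congr determinant; apply/matrixP => i j; rewrite !mxE /level_fun ltn_ord.
  by rewrite subnn.
case: N => [|N]; first by rewrite addnS.
rewrite addnS => -[NE] gk gn.
have KN : (K <= N)%N by lia.
transitivity (\prod_(K <= M < N) \prod_(i < M) q ^+ i.+1 *
  \sum_(mu <- interlacing nu) q ^ weight mu * \det (\matrix_(i < N, j < N)
     level_fun K (shifted kappa) N j (shifted mu i))).
  rewrite mulr_sumr /= big_seq [RHS]big_seq; apply: eq_bigr => mu mui.
  have gm : GT N mu by apply: (interlace_GT gn); rewrite -(mem_interlacing _ gn).
  by rewrite (IH N) // mulrCA.
rewrite (@sum_interlacing_det _ q N nu _ (level_fun K (shifted kappa) N.+1)) //;
  last by move=> j n jN; exact: level_fun_diff.
rewrite mulrA big_nat_recr //=; congr (_ * \det _).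
apply/matrixP => i j; rewrite !mxE; case: ifP => // jN.
rewrite /level_fun ifN; last by lia.
(* The adjoined column of ones has index j = N, hence exponent 0. *)
have -> : (N.+1.-1 - j = 0)%N by move: (ltn_ord j); lia.
by rewrite expr0 qpoch0 divr1.
Qed.

End LevelFunctions.

(** * The polynomials h_i and the quotient of the q-dimensions *)

Lemma exprz_inj (F : fieldType) (q : F) : q != 0 ->
  (forall m, q ^+ m.+1 != 1) -> injective (fun n : int => q ^ n).
Proof.
move=> q0 qr; suff h m n : m <= n -> q ^ m = q ^ n -> m = n.
  by move=> m n /= e; case/orP: (le_total m n) => /h; [apply | move=> h'; exact/esym/h'].
move=> mn e; apply/eqP; rewrite eq_le mn /= leNgt; apply/negP => lt.
have [k kE] : exists k : nat, n - m = k.+1%:Z.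
  by exists `|n - m|%N.-1; lia.
have := qr k; rewrite -[_ ^+ _]/(q ^ k.+1%:Z) -kE expfzDr // -invr_expz -e.
by rewrite divff ?eqxx // expfz_neq0.
Qed.

(** For x_r = q^-(r+1) and y_r = q^-(L+r+1) this is the polynomial h_(i+1) of the overview. *)
Definition staircase (F : nzRingType) (K : nat) (x y : nat -> F) (i : nat) : {poly F} :=
  \prod_(0 <= r < i) ('X - (x r)%:P) * \prod_(i.+1 <= r < K) ('X - (y r)%:P).

Lemma size_staircase (F : idomainType) K (x y : nat -> F) i : (i < K)%N ->
  (size (staircase K x y i) <= K)%N.
Proof.
move=> iK; apply: leq_trans (size_polyMleq _ _) _.
by rewrite !size_prod_XsubC !size_iota; lia.
Qed.

Lemma horner_staircase (F : comNzRingType) K (x y : nat -> F) i z :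
  (staircase K x y i).[z] =
  \prod_(0 <= r < i) (z - x r) * \prod_(i.+1 <= r < K) (z - y r).
Proof.
rewrite hornerM !horner_prod.
by congr (_ * _); apply: eq_bigr => r _; rewrite hornerXsubC.
Qed.

Lemma det_staircase (F : fieldType) K (x y : nat -> F) : injective x ->
  \det (\matrix_(i < K, m < K) (staircase K x y i)`_m) =
  \prod_(j < K) \prod_(i < j) (x i - y j).
Proof.
move=> x_inj.
have xo_inj : injective (fun i : 'I_K => x i) by move=> i j /x_inj; exact: val_inj.
rewrite (_ : \matrix_(i, m) _ = \matrix_(i < K, m < K)
     (\prod_(r < K | (r < i)%N) ('X - (x r)%:P) *
      \prod_(r < K | (i < r)%N) ('X - (y r)%:P))`_m); last first.
  apply/matrixP => i m; rewrite !mxE /staircase big_mkord big_geq_mkord.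
  by rewrite (big_ord_widen K (fun r => 'X - (x r)%:P)) // ltnW.
rewrite (det_coef_staircase (fun r : 'I_K => y r) xo_inj).
rewrite (exchange_big_dep xpredT) //=; apply: eq_bigr => j _.
by rewrite (big_ord_widen K (fun i => x i - y j)) // ltnW.
Qed.

Lemma det_col_scale (A : comNzRingType) n (M : 'M[A]_n) (d : 'I_n -> A) :
  \det (\matrix_(i, j) (M i j * d j)) = \prod_j d j * \det M.
Proof.
rewrite (_ : \matrix_(i, j) _ = M *m diag_mx (\row_j d j)).
  rewrite det_mulmx det_diag mulrC; congr (_ * _).
  by apply: eq_bigr => j _; rewrite mxE.
by apply/matrixP => i j; rewrite mul_mx_diag !mxE.
Qed.

Lemma prod_ord_rev (A : comPzSemiRingType) n (f : nat -> A) :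
  \prod_(j < n) f (n.-1 - j)%N = \prod_(j < n) f j.
Proof.
rewrite [RHS](reindex_inj rev_ord_inj); apply: eq_bigr => j _ /=.
by congr f; lia.
Qed.

Section DimensionRatio.
Variables (F : fieldType) (q : F) (K l : nat) (kappa nu : seq int).
Hypothesis q_neq0 : q != 0.
Hypothesis q_not_root : forall m, q ^+ m.+1 != 1.
Hypotheses (kappa_GT : GT K kappa) (nu_GT : GT (K + l.+1) nu).
Let a (r : 'I_(K + l.+1)) : F := q ^ shifted nu r.
Let Q m := qpoch q^-1 q^-1 m.
Let c M : F := \prod_(i < M) q ^+ i.+1.

Lemma shifted_node_inj : injective a.
Proof.
move=> r s /(exprz_inj q_neq0 q_not_root)/(shifted_inj nu_GT) e.
by apply: val_inj; apply: e.
Qed.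

(** The denominator is the case K = 0, a Vandermonde determinant with columns scaled by 1/Q_p for
    all p < N. Against the numerator, the c_M with M >= K and the Q_p with p < L cancel. *)
Lemma chain_sum_ratio :
  chain_sum q l.+1 kappa nu / chain_sum q (K + l.+1) [::] nu =
  (\prod_(M < K) c M)^-1 * \prod_(l.+1 <= p < K + l.+1) Q p *
  \det (\matrix_(i < K, j < K) \sum_r a r ^+ i *
    iterated_delta q l.+1 (shifted kappa j) (shifted nu r) / node_weight a r).
Proof.
rewrite -(det_interpolation shifted_node_inj (fun j r =>
  iterated_delta q l.+1 (shifted kappa j) (shifted nu r))).
rewrite (chain_sum_det q_neq0 q_not_root _ kappa_GT nu_GT) //.
rewrite (@chain_sum_det _ q q_neq0 q_not_root 0 [::] (K + l.+1)
  (K + l.+1) _ erefl _ nu_GT) //.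
set M := row_mx _ _.
pose M0 : 'M[F]_(K + l.+1) := \matrix_(r, j) a r ^+ ((K + l.+1).-1 - j).
rewrite -/M0.
have Q0 m : Q m != 0 by exact: qpochV_neq0.
have c0 m : c m != 0 by apply/prodf_neq0 => i _; rewrite expf_neq0.
have -> : \det (\matrix_(i < K + l.+1, j < K + l.+1)
    level_fun q K (shifted kappa) (K + l.+1) j (shifted nu i)) =
    (\prod_(p < l.+1) Q p)^-1 * \det M.
  (* The first K columns carry no scalar; column K + k carries 1/Q_(L-1-k). *)
  rewrite (_ : _^-1 = \prod_(j < K + l.+1)
      (if (j < K)%N then 1 else (Q ((K + l.+1).-1 - j)%N)^-1)).
    rewrite -det_col_scale; congr determinant; apply/matrixP => i j.
    rewrite !mxE /level_fun; case: splitP => k jk; rewrite !mxE jk.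
      by rewrite mulr1 addKn.
    rewrite (_ : (K + l.+1).-1 - (K + k) = l.+1.-1 - k)%N //; lia.
  rewrite big_split_ord /= [X in _ = X * _]big1 => [|j _]; last by rewrite ltn_ord.
  rewrite mul1r -prodfV -(prod_ord_rev _ (fun p => (Q p)^-1)).
  apply: eq_bigr => j _; rewrite ifN; last by lia.
  by congr (Q _)^-1; lia.
have -> : \det (\matrix_(i < K + l.+1, j < K + l.+1)
    level_fun q 0 (shifted [::]) (K + l.+1) j (shifted nu i)) =
    (\prod_(p < K + l.+1) Q p)^-1 * \det M0.
  rewrite -prodfV -(prod_ord_rev _ (fun p => (Q p)^-1)) -det_col_scale.
  by congr determinant; apply/matrixP => i j; rewrite !mxE.
have detM0 : \det M0 != 0 by apply: det_nodes_neq0; exact: shifted_node_inj.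
rewrite -!(big_mkord xpredT).
rewrite (@big_cat_nat _ _ _ K 0 (K + l.+1)) ?leq_addr //=.
rewrite (@big_cat_nat _ _ _ l.+1 0 (K + l.+1)) ?leq_addl //=.
have p0 (f : nat -> F) m n : (forall i, f i != 0) -> \prod_(m <= i < n) f i != 0.
  move=> f0; elim/big_rec: _ => [|i x _ x0]; first exact: oner_neq0.
  exact: mulf_neq0.
have h1 := p0 _ K (K + l.+1)%N c0; have h2 := p0 _ 0%N K c0.
have h3 := p0 _ l.+1 (K + l.+1)%N Q0; have h4 := p0 _ 0%N l.+1 Q0.
move: h1 h2 h3 h4 detM0; rewrite /c /Q.
set c1 := \prod_(K <= _ < _) _; set c2 := \prod_(0 <= _ < K) _.
set Q1 := \prod_(l.+1 <= _ < _) _; set Q2 := \prod_(0 <= _ < l.+1) _.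
move: (\det M) (\det M0) => d d0; move: c1 c2 Q1 Q2 => c1 c2 Q1 Q2 h1 h2 h3 h4 h5.
by field; rewrite h1 h2 h3 h4 h5.
Qed.

(** The double product is put in the shape of [det_staircase], against which it will cancel. For
    fixed j, each factor q^(i+1) of c_j turns a difference into 1 - q^-(L+j-i), and reversing i
    gives the factors of Q_(L+j) / Q_L. *)
Lemma ratio_constant :
  (\prod_(M < K) c M)^-1 * \prod_(l.+1 <= p < K + l.+1) Q p =
  Q l.+1 ^+ K * \prod_(j < K) \prod_(i < j) (q^-1 ^+ i.+1 - q^-1 ^+ (l.+1 + j.+1)).
Proof.
rewrite -prodfV -{1}[l.+1]add0n big_addn addnK big_mkord -big_split /=.
rewrite -[X in _ ^+ X](card_ord K) -prodr_const -big_split /=.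
apply: eq_bigr => j _.
have c0 : c j != 0 by apply/prodf_neq0 => i _; rewrite expf_neq0.
apply: (mulfI c0); rewrite mulVKf // mulrCA -big_split /=.
rewrite /Q /qpoch (@big_cat_nat _ _ _ l.+1) ?leq_addl //=; congr (_ * _).
rewrite -{1}[l.+1]add0n big_addn addnK big_mkord.
rewrite -(prod_ord_rev _ (fun i => 1 - q^-1 * q^-1 ^+ (i + l.+1))).
apply: eq_bigr => i _; rewrite mulrBr -exprMn mulfV // expr1n; congr (_ - _).
rewrite (_ : (l.+1 + j.+1)%N = (i.+1 + (j.-1 - i + l.+1).+1)%N);
  last by move: (ltn_ord i); lia.
by rewrite [in RHS]exprD [in RHS]mulrA -exprMn mulfV // expr1n mul1r -exprS.
Qed.

End DimensionRatio.

(** * The functions qA as sums of residues *)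

Lemma horner_qpoch (A : comNzRingType) (c q z : A) m :
  (qpoch ('X * c%:P) q%:P m).[z] = qpoch (z * c) q m.
Proof.
rewrite /qpoch horner_prod; apply: eq_bigr => k _.
by rewrite -polyC_exp !hornerE.
Qed.

Lemma size_qpoch (A : idomainType) (c q : A) m :
  (size (qpoch ('X * c%:P) q%:P m) <= m.+1)%N.
Proof.
elim: m => [|m IH]; first by rewrite qpoch0 size_poly1.
rewrite qpochSr -mulrA -polyC_exp -polyCM.
apply: leq_trans (size_polyMleq _ _) _.
have : (size (1 - 'X * (c * q ^+ m)%:P)%R <= 2)%N.
  apply: leq_trans (size_polyD _ _) _; rewrite size_poly1 size_polyN geq_max /=.
  by rewrite mulrC mul_polyC (leq_trans (size_scale_leq _ _)) // size_polyX.
by move=> h; rewrite -subn1 leq_subLR add1n (leq_trans (leq_add IH h)) // addn2.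
Qed.

Lemma shifted_le N nu i j : GT N nu -> (i <= j < N)%N ->
  shifted nu j <= shifted nu i.
Proof.
move=> gt /andP[]; rewrite leq_eqVlt => /orP[/eqP->//|ij] jN.
by apply/ltW/(shifted_lt gt); rewrite ij.
Qed.

Lemma exprzN_nat (F : fieldType) (q : F) (r : nat) : q ^ (- r%:Z) = q^-1 ^+ r.
Proof. by rewrite -invr_expz -exprnP exprVn. Qed.

Section ContourValue.
Variables (R : realType) (q : R) (K l : nat) (nu : seq int).
Hypothesis q_neq0 : q != 0.
Hypothesis q_not_root : forall m, q ^+ m.+1 != 1.
Hypothesis nu_GT : GT (K + l.+1) nu.
Let a (r : 'I_(K + l.+1)) : R := q ^ shifted nu r.
Let X (r : nat) : R := q^-1 ^+ r.+1.
Let Y (r : nat) : R := q^-1 ^+ (l.+1 + r.+1).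

(** All exponents of the nodes lie between nu_N - N and nu_1 - 1, the range in which the contour is
    prescribed. *)
Lemma winding_node x g (r : 'I_(K + l.+1)) : is_qC q (K + l.+1) nu x g ->
  ~ on_contour g (a r)%:C /\ winding g (a r)%:C = (x <= shifted nu r)%R%:R.
Proof.
move=> [_ po enc out].
have h0 : shifted nu r <= part nu 1 - 1.
  by have := @shifted_le _ nu 0 r nu_GT; rewrite ltn_ord; apply.
have hN : part nu (K + l.+1) - (K + l.+1)%:Z <= shifted nu r.
  have := @shifted_le _ nu r (K + l.+1).-1 nu_GT.
  have -> : shifted nu (K + l.+1).-1 = part nu (K + l.+1) - (K + l.+1)%:Z.
    by rewrite /shifted /part prednK // addnS.
  by apply; move: (ltn_ord r); lia.
case: (leP x (shifted nu r)) => xr.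
  have e : encircles g (a r)%:C by apply: enc; rewrite xr.
  by split; [case: e | exact: po].
by apply: out; rewrite hN /=; lia.
Qed.

(** The denominator cancels a middle block of the factors z - q^-r, and the remaining ones form the
    staircase polynomial. At a cancelled point division by zero makes the integrand 0, hence the
    exclusion. *)
Lemma qA_integrand_rational (i : nat) x (z : R[i]) : (i < K)%N ->
  z \notin [seq (q ^ (- r%:Z))%:C | r <- iota 1 (K + l.+1)] ->
  qA_integrand q K (K + l.+1) nu i.+1 x z =
  (qpoch ('X * (q ^ (1 - x))%:C%:P) (q%:C)%:P l *
   staircase K (fun r => (X r)%:C) (fun r => (Y r)%:C) i).[z] /
  \prod_r (z - (a r)%:C).
Proof.
move=> iK zS; rewrite /qA_integrand addKn /=.
rewrite hornerM horner_qpoch horner_staircase prodf_div.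
pose f (r : nat) : R[i] := z - (q ^ (- r%:Z))%:C.
have -> : \prod_(1 <= r < (K + l.+1).+1) (z - (q ^ (part nu r - r%:Z))%:C) =
    \prod_r (z - (a r)%:C) by rewrite big_add1 big_mkord.
rewrite -[\prod_(1 <= r < _) (z - _)]/(\prod_(1 <= r < (K + l.+1).+1) f r).
rewrite -[\prod_(i.+1 <= r < _.+1) (z - _)]/(\prod_(i.+1 <= r < (l.+1 + i.+1).+1) f r).
set mid := \prod_(i.+1 <= r < (l.+1 + i.+1).+1) f r.
have mid0 : mid != 0.
  rewrite /mid prodf_seq_neq0; apply/allP => r.
  rewrite mem_index_iota => /andP[ir rl] /=.
  rewrite subr_eq0; apply: contra zS => /eqP ->; apply/mapP; exists r => //.
  by rewrite mem_iota; lia.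
rewrite (@big_cat_nat _ _ _ i.+1 1 (K + l.+1).+1) //=; last by lia.
rewrite (@big_cat_nat _ _ _ (l.+1 + i.+1).+1 i.+1 (K + l.+1).+1) //=; try lia.
rewrite -/mid.
have -> : \prod_(1 <= r < i.+1) f r = \prod_(0 <= r < i) (z - (X r)%:C).
  by rewrite big_add1; apply: eq_bigr => r _; rewrite /f exprzN_nat.
have -> : \prod_((l.+1 + i.+1).+1 <= r < (K + l.+1).+1) f r =
    \prod_(i.+1 <= r < K) (z - (Y r)%:C).
  rewrite (_ : (l.+1 + i.+1).+1 = i.+1 + l.+2)%N; last by lia.
  rewrite big_addn (_ : (K + l.+1).+1 - l.+2 = K)%N; last by lia.
  apply: eq_bigr => r _; rewrite /f exprzN_nat /Y; congr (_ - (_ ^+ _)%:C); lia.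
set u := qpoch _ _ _; set v := (\prod_r _)^-1.
set s := \prod_(0 <= r < i) _; set t := \prod_(i.+1 <= r < K) _.
move: mid mid0 => m m0; rewrite -!mulrA; congr (_ * _).
by rewrite [s * _]mulrCA mulKf.
Qed.

Lemma qA_value (i : nat) x g : (i < K)%N -> is_qC q (K + l.+1) nu x g ->
  qA q K (K + l.+1) nu g i.+1 x =
  ((1 - q ^+ l.+1) * \sum_(r < K + l.+1) (x <= shifted nu r)%R%:R *
     qpoch (a r * q ^ (1 - x)) q l * (staircase K X Y i).[a r] /
     node_weight a r)%:C.
Proof.
move=> iK gC; have [gs _ _ _] := gC.
pose aC r := (a r)%:C.
have a_inj : injective a by exact: shifted_node_inj.
have aC_inj : injective aC by move=> r s /complexI /a_inj.
pose P := qpoch ('X * (q ^ (1 - x))%:C%:P) (q%:C)%:P l *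
   staircase K (fun r => (X r)%:C) (fun r => (Y r)%:C) i.
(* The degree is at most l + (K - 1) = N - 2, so the partial fractions have no polynomial part. *)
have sP : (size P <= K + l.+1)%N.
  apply: leq_trans (size_polyMleq _ _) _.
  rewrite -subn1 leq_subLR add1n.
  apply: leq_trans (leq_add (size_qpoch _ _ _) (size_staircase _ _ iK)) _.
  lia.
rewrite /qA addKn.
rewrite (@contour_integral_partial_fractions _ g gs _ aC
  (fun r => P.[aC r] / node_weight aC r)
  [seq (q ^ (- r%:Z))%:C | r <- iota 1 (K + l.+1)]) => [|r|z za zS].
- rewrite mulrA divfK ?two_pi_i_neq0 // rmorphM rmorph_sum /=; congr (_ * _).
  apply: eq_bigr => r _; have [_ ->] := winding_node r gC.
  have -> : node_weight aC r = (node_weight a r)%:C.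
    by rewrite /node_weight rmorph_prod; apply: eq_bigr => s _; rewrite rmorphB.
  have -> : P.[aC r] = (qpoch (a r * q ^ (1 - x)) q l * (staircase K X Y i).[a r])%:C.
    rewrite /P hornerM horner_qpoch !horner_staircase /qpoch !rmorphM !rmorph_prod.
    congr (_ * (_ * _)); apply: eq_bigr => k _; rewrite rmorphB //.
    by rewrite /= !rmorphM rmorphXn.
  by rewrite !rmorphM fmorphV rmorph_nat /=; ring.
- by have [] := winding_node r gC.
- by rewrite qA_integrand_rational // (partial_fractions aC_inj sP).
Qed.

End ContourValue.

(** Apply 1 - q^-k = - q^-k (1 - q^k) to each factor. *)
Lemma qpochV (F : fieldType) (q : F) m : q != 0 ->
  qpoch q^-1 q^-1 m = (-1) ^+ m * q^-1 ^+ (\sum_(k < m) k.+1) * qpoch q q m.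
Proof.
move=> q0; elim: m => [|m IH]; first by rewrite !qpoch0 big_ord0 !mulr1.
rewrite !qpochSr IH big_ord_recr /= exprD [(-1) ^+ m.+1]exprS.
rewrite -[q^-1 * _]exprS -[q * _]exprS [q^-1 ^+ m.+1]exprVn.
have : q ^+ m.+1 != 0 by rewrite expf_neq0.
move: (q ^+ m.+1) (q^-1 ^+ _) ((-1) ^+ m) => b c d b0; field; exact: b0.
Qed.

Lemma sum_shifted K kappa : GT K kappa ->
  \sum_(j < K) shifted kappa j = weight kappa - (\sum_(k < K) k.+1)%:Z.
Proof.
move=> [<- _]; rewrite /shifted /weight (big_nth 0) big_mkord sumrB.
by congr (_ - _); rewrite -[RHS]natz natr_sum; apply: eq_bigr => k _; rewrite natz.
Qed.

Lemma double_sum_succ n : ((\sum_(k < n) k.+1) * 2 = n * n.+1)%N.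
Proof.
elim: n => [|n IH]; first by rewrite big_ord0.
by rewrite big_ord_recr /= mulnDl IH; lia.
Qed.

(** * Comparison of the two K x K determinants *)

Section Assembly.
Variables (R : realType) (q : R) (K l : nat) (kappa nu : seq int).
Hypothesis q_gt0 : 0 < q.
Hypothesis q_lt1 : q < 1.
Hypotheses (kappa_GT : GT K kappa) (nu_GT : GT (K + l.+1) nu).
Let a (r : 'I_(K + l.+1)) : R := q ^ shifted nu r.
Let X (r : nat) : R := q^-1 ^+ r.+1.
Let Y (r : nat) : R := q^-1 ^+ (l.+1 + r.+1).
Let T (n : nat) : nat := \sum_(k < n) k.+1.

Let q_neq0 : q != 0. Proof. by rewrite gt_eqF. Qed.
Let q_not_root m : q ^+ m.+1 != 1.
Proof. by rewrite lt_eqF // exprn_ilt1 // ltW. Qed.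

(** Expanding the staircase polynomials in powers of z factors the matrix through their coefficient
    matrix. In column j, 1 - q^L completes (q; q)_(L-1) to (q; q)_L, so the residue term is
    [iterated_delta] times (q; q)_L q^(-L k_j). *)
Lemma det_residues :
  \det (\matrix_(i < K, j < K) ((1 - q ^+ l.+1) *
    \sum_(r < K + l.+1) (shifted kappa j <= shifted nu r)%R%:R *
     qpoch (a r * q ^ (1 - shifted kappa j)) q l * (staircase K X Y i).[a r] /
     node_weight a r)) =
  qpoch q q l.+1 ^+ K * q ^ (- (l.+1%:Z * \sum_(j < K) shifted kappa j)) *
  (\prod_(j < K) \prod_(i < j) (X i - Y j)) *
  \det (\matrix_(i < K, j < K) \sum_r a r ^+ i *
    iterated_delta q l.+1 (shifted kappa j) (shifted nu r) / node_weight a r).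
Proof.
have X_inj : injective X.
  move=> r s; rewrite /X -!exprzN_nat => /(exprz_inj q_neq0 q_not_root).
  by lia.
rewrite -(det_staircase _ _ X_inj).
set H := \matrix_(i, m) (staircase _ _ _ _)`_m.
set B := \matrix_(i, j) \sum_r a r ^+ _ * _ / _.
pose d (j : 'I_K) := qpoch q q l.+1 * q ^ (- (l.+1%:Z * shifted kappa j)).
have -> : qpoch q q l.+1 ^+ K * q ^ (- (l.+1%:Z * \sum_(j < K) shifted kappa j)) =
    \prod_j d j.
  rewrite [RHS]big_split /= big_const_ord iter_mulr_1; congr (_ * _).
  rewrite mulr_sumr -sumrN.
  by elim/big_rec2: _ => [|j x y _ <-]; rewrite ?expfzDr.
rewrite -mulrA -det_mulmx -det_col_scale; congr determinant.
apply/matrixP => i j; rewrite !mxE mulr_suml mulr_sumr.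
under [RHS]eq_bigr do rewrite !mxE mulr_sumr mulr_suml.
rewrite exchange_big /=; apply: eq_bigr => r _.
rewrite (horner_coef_wide _ (size_staircase X Y (ltn_ord i))).
rewrite mulr_sumr mulr_suml mulr_sumr; apply: eq_bigr => m _.
rewrite /d /iterated_delta; case: leP => _; last by rewrite !(mul0r, mulr0).
rewrite mul1r (_ : a r * q ^ (1 - shifted kappa j) =
  q ^ (shifted nu r - shifted kappa j + 1)); last first.
  by rewrite /a -expfzDr //; congr (_ ^ _); lia.
rewrite qpochSr -exprS -invr_expz.
have h1 : q ^ (l.+1%:Z * shifted kappa j) != 0 by rewrite expfz_neq0.
have h2 := qpoch_neq0 q_not_root l.
have h3 : node_weight a r != 0.
  by apply: node_weight_neq0; exact: shifted_node_inj nu_GT.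
move: h1 h2 h3 => /=.
by move=> h1 h2 h3; field; rewrite h1 h2 h3.
Qed.

(** Inverting the base gives the sign and q^(-K T(L)), and the shifts in the k_j give q^(-L T(K)),
    where T(n) = n(n+1)/2. The sum K T(L) + L T(K) equals K L (N + 2) / 2, so the real power is an
    integer one. *)
Lemma prefactor : qpoch q^-1 q^-1 l.+1 ^+ K =
  (-1) ^+ (K * l.+1) * q ^ (l.+1%:Z * weight kappa) *
  (q `^ (- (K * l.+1 * (K + l.+1 + 2))%:R / 2)) *
  (qpoch q q l.+1 ^+ K * q ^ (- (l.+1%:Z * \sum_(j < K) shifted kappa j))).
Proof.
have TE : ((T l.+1 * K + T K * l.+1) * 2 = K * l.+1 * (K + l.+1 + 2))%N.
  have := double_sum_succ K; have := double_sum_succ l.+1.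
  rewrite -/(T K) -/(T l.+1) => h1 h2.
  rewrite mulnDl mulnAC h1 [X in (_ + X)%N]mulnAC h2; lia.
have -> : q `^ (- (K * l.+1 * (K + l.+1 + 2))%:R / 2) =
    q ^ (- (T l.+1 * K + T K * l.+1)%:Z).
  rewrite -TE natrM mulNr mulfK ?pnatr_eq0 // powRN powR_mulrn ?ltW //.
  by rewrite -invr_expz.
rewrite (sum_shifted kappa_GT) -/(T K) qpochV // -/(T l.+1).
rewrite !exprMn -!exprM [(l.+1 * K)%N]mulnC.
rewrite [RHS](_ : _ = (-1) ^+ (K * l.+1) * (q ^ (l.+1%:Z * weight kappa) *
  q ^ (- (T l.+1 * K + T K * l.+1)%:Z) *
  q ^ (- (l.+1%:Z * (weight kappa - (T K)%:Z)))) * qpoch q q l.+1 ^+ K); last by ring.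
rewrite -!expfzDr // -exprzN_nat; congr (_ * q ^ _ * _).
move: (weight kappa) => W; rewrite !PoszD !PoszM; ring.
Qed.

End Assembly.

Theorem theorem1p5 (R : realType) (q : R) (K N : nat) (kappa nu : seq int)
    (qC : int -> R -> R[i]) :
  0 < q < 1 -> (1 <= K < N)%N -> GT K kappa -> GT N nu ->
  (forall x : int, is_qC q N nu x (qC x)) ->
  (qDimK q K N kappa nu / qDim q N nu)%:C =
    (-1) ^+ (K * (N - K))
    * (q ^ ((N - K)%:Z * weight kappa))%:C
    * (q `^ (- (K * (N - K) * (N + 2))%:R / 2))%:C
    * \det (\matrix_(i < K, j < K)
        let x := part kappa j.+1 - (j.+1)%:Z in
        qA q K N nu (qC x) i.+1 x).
Proof.
move=> /andP[q0 q1] /andP[K1 KN] kG nG gC.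
have [l NE] : exists l, N = (K + l.+1)%N by exists (N - K).-1; lia.
move: KN nG gC; rewrite {N}NE addKn => _ nG gC.
have qn0 : q != 0 by rewrite gt_eqF.
have qr m : q ^+ m.+1 != 1 by rewrite lt_eqF // exprn_ilt1 // ltW.
(* The full q-dimension is the case of level 0 and empty kappa, which needs N as a successor. *)
have [N' NE] : exists N', (K + l.+1)%N = N'.+1 by exists (K + l)%N; rewrite addnS.
have -> : qDim q (K + l.+1) nu = chain_sum q (K + l.+1) [::] nu.
  rewrite qDim_qDimK; move: nG; rewrite NE => nG.
  exact: (@qDimK_chain_sum _ q 0 N' [::] nu qn0 nG).
rewrite qDimK_chain_sum // (chain_sum_ratio qn0 qr kG nG) ratio_constant //.
rewrite (prefactor l q0 q1 kG).
(* By [qA_value] all entries are real, so the determinant can be computed over the reals. *)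
rewrite [X in _ = _ * \det X](_ : _ = map_mx (real_complex R) (\matrix_(i < K, j < K)
  ((1 - q ^+ l.+1) *
    \sum_(r < K + l.+1) (shifted kappa j <= shifted nu r)%R%:R *
     qpoch (q ^ shifted nu r * q ^ (1 - shifted kappa j)) q l *
     (staircase K (fun r => q^-1 ^+ r.+1) (fun r => q^-1 ^+ (l.+1 + r.+1))
        i).[q ^ shifted nu r] /
     node_weight (fun r : 'I_(K + l.+1) => q ^ shifted nu r) r))); last first.
  apply/matrixP => i j; rewrite !mxE; exact: (qA_value qn0 qr nG).
rewrite det_map_mx (det_residues kappa q0 q1 nG) !rmorphM /= rmorphXn rmorphN1.
by rewrite !mulrA.
Qed.
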